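(* Let $d$ be a square-free positive integer, let $F=\mathbb{Q}(\sqrt{d})$ be a real quadratic field, and let $\Delta_d$ be the discriminant of $F$. If $$\Delta_d>(576283867731072000000005)^2,$$ then there is no positive definite non-classic universal quadratic $\mathcal{O}_F$-lattice of rank $7$.
   Context: $\mathcal{O}_F$ is the ring of algebraic integers of $F=\mathbb{Q}(\sqrt d)$ (with $d>1$), and $\mathcal{O}_F^+\subset\mathcal{O}_F$ is the set of totally positive elements (those that are positive under both real embeddings of $F$). The discriminant is $\Delta_d=4d$ if $d\equiv 2,3 \pmod 4$ and $\Delta_d=d$ if $d\equiv 1\pmod 4$. A quadratic $\mathcal{O}_F$-lattice is a finitely generated $\mathcal{O}_F$-module $L$ (not necessarily free) equipped with a quadratic map $Q:L\to\mathcal{O}_F$ for which $B(x,y):=\frac{Q(x+y)-Q(x)-Q(y)}{2}$ is a symmetric $\mathcal{O}_F$-bilinear form on $L$ (with values in $F$) with $B(x,x)=Q(x)$. It is classic if $B(x,y)\in\mathcal{O}_F$ for all $x,y\in L$, and non-classic otherwise. It is positive definite if $Q(x)\in\mathcal{O}_F^+$ for all $x\in L\setminus\{0\}$. A positive definite quadratic $\mathcal{O}_F$-lattice $L$ is universal if $Q(L)=\mathcal{O}_F^+\cup\{0\}$. The rank of $L$ is $\dim_F(F\otimes_{\mathcal{O}_F}L)$. *)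

(* Defs.v *)
From Stdlib Require Import NArith Rdefinitions.
From HB Require Import structures.
From mathcomp Require Import all_boot all_order all_algebra all_field.
From mathcomp Require Import sesquilinear.
From mathcomp Require Import boolp classical_sets.
From mathcomp Require Import Rstruct.

Set Implicit Arguments.
Unset Strict Implicit.
Unset Printing Implicit Defensive.

Import Order.TTheory GRing.Theory Num.Theory.

Local Open Scope ring_scope.

Definition square_free (d : nat) : Prop :=
  forall p : nat, prime p -> ~~ (p ^ 2 %| d)%N.

Definition discr (d : nat) : nat := if d == 1 %[mod 4] then d else (4 * d)%N.

Definition is_Q_sqrt (d : nat) (F : fieldExtType rat) : Prop :=
  exists2 s : F, s ^+ 2 = d%:R & <<1; s>>%VS = {:F}%VS.

Section IntegerRing.

Variable F : fieldExtType rat.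

Definition alg_integer : {pred F} :=
  fun x => `[< integralOver (intr : int -> F) x >].

Lemma alg_integerP (x : F) :
  reflect (integralOver (intr : int -> F) x) (x \in alg_integer).
Proof. exact: asboolP. Qed.

Lemma alg_integer_subring : subring_closed alg_integer.
Proof.
split=> [|x y /alg_integerP hx /alg_integerP hy|x y /alg_integerP hx /alg_integerP hy];
  apply/alg_integerP.
- exact: (@integral1 int F intr).
- exact: (@integral_sub int F intr).
- exact: (@integral_mul int F intr).
Qed.

HB.instance Definition _ :=
  GRing.isSubringClosed.Build F alg_integer alg_integer_subring.

Record int_ring := IntRing { int_val : F; int_valP : int_val \in alg_integer }.

HB.instance Definition _ := [isSub for int_val].
HB.instance Definition _ := [Choice of int_ring by <:].
HB.instance Definition _ := [SubChoice_isSubComNzRing of int_ring by <:].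

Local Notation ofi := (val : int_ring -> F).

Definition tot_pos (a : int_ring) : Prop :=
  forall sigma : {rmorphism F -> Rdefinitions.R}, 0 < sigma (val a).

Definition fin_generated (L : lmodType int_ring) : Prop :=
  exists (n : nat) (e : 'I_n -> L),
    forall x : L, exists c : 'I_n -> int_ring, x = \sum_i c i *: e i.

Definition polar (L : lmodType int_ring) (Q : L -> int_ring) (x y : L) : F :=
  (val (Q (x + y)) - val (Q x) - val (Q y)) / 2%:R.

Record quad_lattice := QuadLattice {
  lat_mod :> lmodType int_ring;
  lat_fg : fin_generated lat_mod;
  quad : lat_mod -> int_ring;
  quad_polar_sym : forall x y, polar quad x y = polar quad y x;
  quad_polar_bilinear :
    bilinear_for (ofi \; *%R) (ofi \; *%R) (polar quad);
  quad_polar_diag : forall x, polar quad x x = val (quad x)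
}.

(* The universal property defining V = F (x) L, with iota x = 1 (x) x; the
   codomain of iota and f is an int_ring-module through the inclusion in F. *)
Definition is_scalar_ext (L : lmodType int_ring) (V : lmodType F)
    (iota : {linear L -> V | ofi \; *:%R}) : Prop :=
  forall (W : lmodType F) (f : {linear L -> W | ofi \; *:%R}),
    (exists g : {linear V -> W}, g \o iota =1 f) /\
    (forall g h : {linear V -> W}, g \o iota =1 f -> h \o iota =1 f -> g =1 h).

Definition has_rank (L : lmodType int_ring) (n : nat) : Prop :=
  exists (V : vectType F)
         (iota : {linear L -> V | ofi \; *:%R}),
    is_scalar_ext iota /\ \dim {:V} = n.

Definition is_classic (L : quad_lattice) : Prop :=
  forall x y : L, polar (@quad L) x y \in alg_integer.

Definition pos_definite (L : quad_lattice) : Prop :=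
  forall x : L, x != 0 -> tot_pos (quad x).

Definition universal (L : quad_lattice) : Prop :=
  (range (@quad L) = [set a | tot_pos a] `|` [set 0])%classic.

End IntegerRing.

(* Main.v *)
Require Import Defs.
From Stdlib Require Import NArith ZArith.
From HB Require Import structures.
From mathcomp Require Import all_boot all_order all_algebra all_field.
From mathcomp Require Import perm ssrZ zify ring lra.
From mathcomp Require Import boolp classical_sets Rstruct.

(** A universal lattice has rank at least 8 as soon as the discriminant is large, because it
    contains two positive quaternary integral forms that barely interact.

    Let [S] be the square root of the discriminant, let [s1], [s2] be the two real embeddings of
    [F], and choose a totally positive integer [alpha] with [s1 alpha - s2 alpha = S] and
    [s2 alpha <= 1].  On algebraic integers [s1 - s2] takes its values in [S * Z]
    ([real_quadratic_embeddings]), so an algebraic integer whose two conjugates are small compared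
    with [S] is a rational integer.

    Universality gives vectors [x k] of norm [k] and [w k] of norm [k * alpha], for [k <= 31].  By
    Cauchy-Schwarz in both embeddings, the pairings [2B(x k, x l)] are rational integers, and
    those of the [w k] have the form [c * alpha + e] with [c] a rational integer and [e] bounded
    under both embeddings.  In both cases the rational integers found form the Gram table of an
    integral quadratic form that represents 1, 2, ..., 31 and is nonnegative on short vectors.
    No such form has rank less than 4: that is the escalation argument of Conway, Schneeberger
    and Bhargava in its finite form ([escalation]), which extracts four vectors with nonzero Gram
    determinant.  Hence the eight vectors selected among the [x k] and the [w l] have under [s1] a
    Gram matrix with diagonal blocks [A] and [S * B + E], where [A] and [B] are integral with
    nonzero determinant and [A], [E] and the off-diagonal block are bounded, the latter because
    the pairings [2B(x k, w l)] have equal conjugates.  For large [S] such a matrix is nonsingular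
    ([block_kernel_trivial]).  Since a lattice of rank less than 8 has singular 8 by 8 Gram
    matrices ([gram_kernel]), the rank is at least 8.

    All entries are at most [2 * 31 = 62], and with that bound [S > 10 ^ 20] is large enough. *)

Set Implicit Arguments.
Unset Strict Implicit.
Unset Printing Implicit Defensive.

Import Order.TTheory GRing.Theory Num.Theory.
Local Open Scope ring_scope.

Local Notation R := Rdefinitions.R.

(** * Escalation of integral quadratic forms *)

Lemma det2E (R : comNzRingType) (f : nat -> nat -> R) :
  \det (\matrix_(i < 2, j < 2) f i j) = f 0%N 0%N * f 1%N 1%N - f 0%N 1%N * f 1%N 0%N.
Proof.
rewrite (expand_det_row _ ord0) !big_ord_recl big_ord0 /cofactor !det_mx11 !mxE /=.
by rewrite /bump /=; ring.
Qed.

Lemma det3E (R : comNzRingType) (f : nat -> nat -> R) :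
  \det (\matrix_(i < 3, j < 3) f i j) =
     f 0%N 0%N * (f 1%N 1%N * f 2%N 2%N - f 1%N 2%N * f 2%N 1%N)
     - f 0%N 1%N * (f 1%N 0%N * f 2%N 2%N - f 1%N 2%N * f 2%N 0%N)
     + f 0%N 2%N * (f 1%N 0%N * f 2%N 1%N - f 1%N 1%N * f 2%N 0%N).
Proof.
have E k : \det (row' ord0 (col' k (\matrix_(i < 3, j < 3) f i j))) =
    \det (\matrix_(i < 2, j < 2) (fun a b => f a.+1 (bump k b)) i j).
  by congr (\det _); apply/matrixP=> i j; rewrite !mxE.
rewrite (expand_det_row _ ord0) !big_ord_recl big_ord0 /cofactor !E.
by rewrite !(det2E (fun a b => f a.+1 (bump _ b))) !mxE /= /bump /=; ring.
Qed.

Lemma det4E (R : comNzRingType) (f : nat -> nat -> R) :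
  let m a b := f 2%N a * f 3%N b - f 2%N b * f 3%N a in
  \det (\matrix_(i < 4, j < 4) f i j) =
     f 0%N 0%N * (f 1%N 1%N * m 2%N 3%N - f 1%N 2%N * m 1%N 3%N + f 1%N 3%N * m 1%N 2%N)
     - f 0%N 1%N * (f 1%N 0%N * m 2%N 3%N - f 1%N 2%N * m 0%N 3%N + f 1%N 3%N * m 0%N 2%N)
     + f 0%N 2%N * (f 1%N 0%N * m 1%N 3%N - f 1%N 1%N * m 0%N 3%N + f 1%N 3%N * m 0%N 1%N)
     - f 0%N 3%N * (f 1%N 0%N * m 1%N 2%N - f 1%N 1%N * m 0%N 2%N + f 1%N 2%N * m 0%N 1%N).
Proof.
move=> m.
have E k : \det (row' ord0 (col' k (\matrix_(i < 4, j < 4) f i j))) =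
    \det (\matrix_(i < 3, j < 3) (fun a b => f a.+1 (bump k b)) i j).
  by congr (\det _); apply/matrixP=> i j; rewrite !mxE.
rewrite (expand_det_row _ ord0) !big_ord_recl big_ord0 /cofactor !E.
by rewrite !(det3E (fun a b => f a.+1 (bump _ b))) !mxE /= /bump /= /m; ring.
Qed.

(** The determinant of the symmetric matrix with diagonal [a], [b], [c] and entries [p], [q], [r]
    in the positions 12, 13, 23. *)
Definition gram3 (R : pzRingType) (a b c p q r : R) : R :=
  a * b * c + 2 * p * q * r - a * r ^+ 2 - b * q ^+ 2 - c * p ^+ 2.

(** Sylvester's identity for the bordered minors of the upper left 2 by 2 block.  It reduces the
    singularity of a quaternary Gram matrix to a product of two ternary determinants being a
    square, which frees the table below from a loop over one of the pairings. *)
Lemma sylvester_gram4 (R : comNzRingType) (f : nat -> nat -> R)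
    (g := fun i => gram3 (f 0%N 0%N) (f 1%N 1%N) (f i i) (f 0%N 1%N) (f 0%N i) (f 1%N i)) :
  (forall i j, f i j = f j i) ->
  exists m : R,
    (f 0%N 0%N * f 1%N 1%N - f 0%N 1%N ^+ 2) * \det (\matrix_(i < 4, j < 4) f i j) =
    g 2%N * g 3%N - m ^+ 2.
Proof.
(* The witness is the minor on rows 0, 1, 2 and columns 0, 1, 3. *)
move=> sym; exists (f 2%N 3%N * (f 0%N 0%N * f 1%N 1%N - f 0%N 1%N ^+ 2)
  - f 0%N 2%N * (f 1%N 1%N * f 0%N 3%N - f 0%N 1%N * f 1%N 3%N)
  - f 1%N 2%N * (f 0%N 0%N * f 1%N 3%N - f 0%N 1%N * f 0%N 3%N)).
rewrite det4E /g /gram3 (sym 1%N 0%N) (sym 2%N 0%N) (sym 2%N 1%N) (sym 3%N 0%N).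
by rewrite (sym 3%N 1%N) (sym 3%N 2%N) /=; ring.
Qed.

Definition Zgram3 (a b c p q r : Z) : Z :=
  (a * b * c + 2%:R * p * q * r - a * (r * r) - b * (q * q) - c * (p * p)).

Lemma Zgram3E (a b c p q r : int) :
  Zgram3 (Z_of_int a) (Z_of_int b) (Z_of_int c) (Z_of_int p) (Z_of_int q) (Z_of_int r) =
    Z_of_int (gram3 a b c p q r).
Proof. by rewrite /Zgram3 /gram3; lia. Qed.

Definition Zsquare (n : Z) : bool := Z.sqrt n * Z.sqrt n == n.

Lemma ZsquareP (m : Z) : Zsquare (m * m)%R.
Proof.
have -> : m * m = Z.mul (Z.abs m) (Z.abs m) by exact/esym/Z.abs_square.
by rewrite /Zsquare Z.sqrt_square //; exact: Z.abs_nonneg.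
Qed.

Definition Zball (n : nat) (P : Z -> bool) : bool :=
  let s := Z.sqrt (Z.of_nat n) in
  all (fun i => P (Z.of_nat i - s)) (iota 0 (Z.to_nat (s + s + 1))).

Lemma ZballP n P (x : int) : Zball n P -> x ^+ 2 <= n%:Z -> P (Z_of_int x).
Proof.
move=> /allP h hx; pose y := Z_of_int x; pose s := Z.sqrt (Z.of_nat n).
have [] := Z.sqrt_spec (Z.of_nat n) (Zle_0_nat n); rewrite -/s => s1 s2.
have hy : Z.le (y * y) (Z.of_nat n) by rewrite /y; lia.
have [y1 y2] : Z.le (- s) y /\ Z.le y s by split; nia.
have := h (Z.to_nat (y + s)).
rewrite Z2Nat.id; last by lia.
by rewrite addrK; apply; rewrite mem_iota -/s; lia.
Qed.

(** A norm that is not represented, even over the rationals, by the binary form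
    x^2 + p x y + 2 y^2, where [p ^ 2 <= 8]. *)
Definition third (p : Z) : nat := if p == 0 then 5%N else 3%N.

Definition fourths : seq nat := [:: 5; 6; 7; 10; 13; 14; 17; 21; 22; 23; 29; 31]%N.

(** Here [p], [q], [r] and [x], [y] run through the pairings that Cauchy-Schwarz allows between
    vectors of norms 1, 2, [k] and 1, 2, [l]; Gram tables with [g < 0] do not arise from positive
    forms.  In the remaining cases some [l] is not represented over the rationals by the ternary
    form: by [sylvester_gram4] a representation makes the tested product a square. *)
Definition escalation_table : bool :=
  let two := Z_of_int 2 in let four := Z_of_int 4 in
  Zball 8 (fun p => let k := third p in let t := Z.of_nat (2 * k) in
  Zball (4 * k) (fun q => Zball (8 * k) (fun r =>
    let g := Zgram3 two four t p q r in
    Z.ltb g Z0 || has (fun l => let u := Z.of_nat (2 * l) in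
       Zball (4 * l) (fun x => Zball (8 * l) (fun y =>
         ~~ Zsquare (g * Zgram3 two four u p x y)%R))) fourths))).

Lemma escalation_tableT : escalation_table.
Proof. by vm_compute. Qed.

(** Entry [c k l] stands for twice the bilinear form on vectors of norms [k] and [l].  Positivity
    is only demanded for short combinations of three vectors, since this is what survives for the
    coefficient of [alpha] in the norms of the [w k]; the bound 30 accommodates the adjugate vector
    in the proof of [escalation]. *)
Record small_gram (c : nat -> nat -> int) : Prop := SmallGram {
  small_gram_diag : forall k, c k k = (2 * k)%:Z;
  small_gram_sym : forall k l, c k l = c l k;
  small_gram_bound : forall k l, (0 < k <= 31)%N -> (0 < l <= 31)%N ->
    c k l ^+ 2 <= (4 * k * l)%:Z;
  small_gram_psd : forall k (x y z : int), (0 < k <= 31)%N ->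
    `|x| <= 30 -> `|y| <= 30 -> `|z| <= 30 ->
    0 <= c 1%N 1%N * x ^+ 2 + c 2%N 2%N * y ^+ 2 + c k k * z ^+ 2
      + 2 * (c 1%N 2%N * x * y + c 1%N k * x * z + c 2%N k * y * z) }.

(** The rows 1 and 2 are independent, [third] gives a norm outside the rational span of the two
    vectors and [fourths] contains one outside the span of the three. *)
Lemma escalation (c : nat -> nat -> int) : small_gram c ->
  exists k : nat -> nat, (forall i, (0 < k i <= 31)%N) /\
    \det (\matrix_(i < 4, j < 4) c (k i) (k j)) != 0.
Proof.
move=> [cD cS cB cP].
pose p := c 1%N 2%N.
have hp : p ^+ 2 <= 8%:Z by apply: (cB 1%N 2%N).
pose k3 := third (Z_of_int p).
have k3b : (0 < k3 <= 31)%N by rewrite /k3 /third; case: ifP.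
have k3b5 : (k3 <= 5)%N by rewrite /k3 /third; case: ifP.
pose q := c 1%N k3; pose r := c 2%N k3.
have hq : q ^+ 2 <= (4 * k3)%:Z by have := cB 1%N k3 isT k3b; lia.
have hr : r ^+ 2 <= (8 * k3)%:Z by have := cB 2%N k3 isT k3b; lia.
pose g := gram3 2 4 (2 * k3)%:Z p q r.
(* The coefficients are the last row of the adjugate of the ternary Gram matrix, so the form takes
   at that vector the product of the determinants of sizes 2 and 3. *)
have g_ge0 : 0 <= g.
  have := cP k3 (p * r - 4 * q) (p * q - 2 * r) (8 - p ^+ 2) k3b.
  rewrite !cD -/p -/q -/r.
  rewrite [X in 0 <= X](_ : _ = (8 - p ^+ 2) * g); last first.
    by rewrite /g /gram3 (_ : (2 * 1)%:Z = 2) // (_ : (2 * 2)%:Z = 4) //; ring.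
  have p2 : `|p| <= 2 by nia.
  have q4 : `|q| <= 4 by nia.
  have r6 : `|r| <= 6 by nia.
  have d2 : 4 <= 8 - p ^+ 2 by nia.
  have a1 : `|p * r - 4 * q| <= 30 by nia.
  have a2 : `|p * q - 2 * r| <= 30 by nia.
  have a3 : `|8 - p ^+ 2| <= 30 by nia.
  by move=> /(_ a1 a2 a3); nia.
have := ZballP escalation_tableT hp; rewrite -/k3.
move=> /ZballP/(_ hq)/ZballP/(_ hr).
have E k a b : Zgram3 (Z_of_int 2) (Z_of_int 4) (Z.of_nat (2 * k)) (Z_of_int p)
    (Z_of_int a) (Z_of_int b) = Z_of_int (gram3 2 4 (2 * k)%:Z p a b).
  exact: (Zgram3E 2 4 (2 * k)%:Z).
rewrite E -/g => /orP[]; first by lia.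
move=> /hasP [l l4].
have lb : (0 < l <= 31)%N.
  by have /allP/(_ l l4) : all (fun l => 0 < l <= 31)%N fourths by [].
pose x := c 1%N l; pose y := c 2%N l.
have hx : x ^+ 2 <= (4 * l)%:Z by have := cB 1%N l isT lb; lia.
have hy : y ^+ 2 <= (8 * l)%:Z by have := cB 2%N l isT lb; lia.
move=> /ZballP/(_ hx)/ZballP/(_ hy); rewrite E => nsq.
pose ks := nth 1%N [:: 1; 2; k3; l]%N.
exists ks; split; first by rewrite /ks => -[|[|[|[|i]]]] /=; rewrite ?nth_nil.
have [|m] := @sylvester_gram4 _ (fun i j => c (ks i) (ks j)).
  by move=> i j; exact: cS.
rewrite !cD /= -/p -/q -/r -/x -/y -[gram3 _ _ (2 * k3)%:Z _ _ _]/g => eqm.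
apply/eqP => det0; move: eqm; rewrite det0 mulr0.
move=> /esym/eqP; rewrite subr_eq0 => /eqP eqm.
move/negP: nsq; apply.
have -> : Z_of_int g * Z_of_int (gram3 2 4 (2 * l)%:Z p x y) = Z_of_int m * Z_of_int m.
  by rewrite -!rmorphM /= -expr2 -eqm.
exact: ZsquareP.
Qed.

(** * Nonsingularity of matrices with large integral blocks *)

Lemma norm_det_le (R : numDomainType) n (M : 'M[R]_n) (m : R) :
  (forall i j, `|M i j| <= m) -> `|(\det M)| <= n`!%:R * m ^+ n.
Proof.
move=> hM; rewrite /determinant.
have -> : n`!%:R * m ^+ n = \sum_(s : 'S_n) m ^+ n.
  by rewrite sumr_const card_Sn mulr_natl.
apply: le_trans (ler_norm_sum _ _ _) _; apply: ler_sum => s _.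
rewrite normrM normrX normrN1 expr1n mul1r normr_prod.
rewrite -[X in _ <= _ ^+ X]card_ord -prodr_const.
by apply: ler_prod => i _; rewrite normr_ge0 hM.
Qed.

(** A nonsingular integral matrix has determinant at least 1 in absolute value, so its inverse is
    bounded by its adjugate, whose entries are minors. *)
Lemma norm_le_int_mulmx (R : realDomainType) n (M : 'M[int]_n.+1) (m e : R)
    (u : 'I_n.+1 -> R) :
  (forall i j, `|(M i j)%:~R| <= m) -> \det M != 0 ->
  (forall i, `|(\sum_j (M i j)%:~R * u j)| <= e) ->
  forall j, `|u j| <= n.+1%:R * (n`!%:R * m ^+ n) * e.
Proof.
move=> hM hdet he j.
have adjE : (\det M)%:~R * u j = \sum_i (\adj M j i)%:~R * (\sum_k (M i k)%:~R * u k).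
  under eq_bigr do rewrite mulr_sumr.
  rewrite exchange_big /=.
  transitivity (\sum_k ((\adj M *m M) j k)%:~R * u k).
    rewrite mul_adj_mx (bigD1 j) //= big1 ?addr0; first by rewrite !mxE eqxx.
    by move=> k kj; rewrite !mxE eq_sym (negPf kj) mul0r.
  apply: eq_bigr => k _; rewrite !mxE rmorph_sum /= mulr_suml.
  by apply: eq_bigr => i _; rewrite rmorphM /= mulrA.
have d1 : 1 <= `|(\det M)%:~R : R|.
  by rewrite -intr_norm -[1]/(1%:~R) ler_int; move: hdet; lia.
apply: (@le_trans _ _ (`|(\det M)%:~R| * `|u j|)); first by rewrite ler_peMl.
rewrite -normrM adjE; apply: le_trans (ler_norm_sum _ _ _) _.
have -> : n.+1%:R * (n`!%:R * m ^+ n) * e = \sum_(i < n.+1) (n`!%:R * m ^+ n) * e.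
  by rewrite sumr_const card_ord -[RHS]mulr_natl !mulrA.
apply: ler_sum => i _; rewrite normrM ler_pM //.
rewrite mxE /cofactor rmorphM /= normrM rmorphXn /= rmorphN1.
rewrite normrX normrN1 expr1n mul1r.
rewrite -det_map_mx; apply: norm_det_le => a b; rewrite !mxE; exact: hM.
Qed.

(** A kernel vector [(p, r)] satisfies [A p = - C r], so [p] is at most a constant times [r];
    then [S * B r] is bounded by a constant times [r], which for large [S] contradicts the
    invertibility of the integral matrix [B]. *)
Lemma block_kernel_trivial (R : realFieldType) (A B : 'M[int]_4)
    (C E : 'I_4 -> 'I_4 -> R) (S : R) (p r : 'I_4 -> R) :
  (forall i j, `|(A i j)%:~R : R| <= 62) -> (forall i j, `|(B i j)%:~R : R| <= 62) ->
  (forall i j, `|C i j| <= 62) -> (forall i j, `|E i j| <= 62) ->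
  \det A != 0 -> \det B != 0 -> 10 ^+ 20 < S ->
  (forall i, \sum_j (A i j)%:~R * p j + \sum_j C i j * r j = 0) ->
  (forall i, \sum_j C j i * p j + \sum_j ((B i j)%:~R * S + E i j) * r j = 0) ->
  (forall i, p i = 0) /\ (forall i, r i = 0).
Proof.
move=> hA hB hC hE dA dB hS eqp eqr.
pose rho := \sum_j `|r j|.
have rho0 : 0 <= rho by apply: sumr_ge0.
(* The factor by which applying the inverse of an integral 4 by 4 matrix with entries at most 62
   can increase the sup norm. *)
pose K : R := 4%:R * (3`!%:R * 62 ^+ 3).
have small (D : 'I_4 -> 'I_4 -> R) i : (forall i j, `|D i j| <= 62) ->
    `|(\sum_j D i j * r j)| <= 62 * rho.
  move=> hD; apply: le_trans (ler_norm_sum _ _ _) _; rewrite mulr_sumr.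
  by apply: ler_sum => j _; rewrite normrM ler_wpM2r.
have hp j : `|p j| <= K * (62 * rho).
  apply: (norm_le_int_mulmx hA dA) => i.
  rewrite -[X in `|X|]opprK normrN (_ : - _ = \sum_j C i j * r j) ?small //.
  by apply/eqP; rewrite eqr_oppLR -addr_eq0 eqp.
have S0 : 0 < S by apply: lt_trans hS; rewrite exprn_gt0.
have hr j : `|r j| <= K * ((4%:R * (62 * (K * (62 * rho))) + 62 * rho) / S).
  apply: (norm_le_int_mulmx hB dB) => i.
  rewrite ler_pdivlMr // -[X in _ * X](gtr0_norm S0) -normrM mulr_suml.
  have -> : \sum_j (B i j)%:~R * r j * S = - (\sum_j C j i * p j) - \sum_j E i j * r j.
    have := eqr i; under [X in _ + X = _]eq_bigr do rewrite mulrDl mulrAC.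
    by rewrite big_split /= addrA => /eqP; rewrite addr_eq0 => /eqP <-; ring.
  apply: le_trans (ler_normB _ _) _; rewrite normrN; apply: lerD; last exact: small.
  have -> : 4%:R * (62 * (K * (62 * rho))) = \sum_(i < 4) (62 * (K * (62 * rho))).
    by rewrite sumr_const card_ord -[RHS]mulr_natl.
  apply: le_trans (ler_norm_sum _ _ _) _; apply: ler_sum => k _.
  by rewrite normrM ler_pM.
have rho_eq0 : rho = 0.
  have : rho <= 4%:R * (K * ((4%:R * (62 * (K * (62 * rho))) + 62 * rho) / S)).
    move: hr; set T := K * (_ / S) => hr.
    have -> : 4%:R * T = \sum_(i < 4) T by rewrite sumr_const card_ord -[RHS]mulr_natl.
    by apply: ler_sum => i _; exact: hr.
  have K0 : 0 <= K by rewrite /K (_ : 3`! = 6)%N //; lra.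
  have K1 : K <= 6 * 100 ^+ 3 by rewrite /K (_ : 3`! = 6)%N //; lra.
  clearbody K; rewrite !mulrA ler_pdivlMr //.
  have K2 : 4%:R * K * (4 * 62 * K * 62 + 62) <= 10 ^+ 20 by nra.
  move=> h; apply/eqP; rewrite eq_le rho0 andbT.
  have {}h : rho * S <= (4%:R * K * (4 * 62 * K * 62 + 62)) * rho.
    by move: h; congr (_ <= _); ring.
  have : rho * S <= 10 ^+ 20 * rho by apply: le_trans h _; rewrite ler_wpM2r.
  by nra.
have r0 i : r i = 0.
  by apply/eqP; rewrite -normr_le0; have := hr i; rewrite rho_eq0; lra.
split=> // i; apply/eqP; rewrite -normr_le0; have := hp i; rewrite rho_eq0; lra.
Qed.

(** * Integers of a real quadratic field and their real embeddings *)

Lemma integral_rat_int (K : numFieldType) (q : rat) :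
  integralOver (intr : int -> K) (ratr q) -> exists n : int, q = n%:~R.
Proof.
move=> [P monP rootP].
have rq : root (map_poly (intr : int -> algC) P) (ratr q).
  move: rootP; have E (L : numFieldType) :
      map_poly (intr : int -> L) P = map_poly ratr (map_poly intr P).
    by rewrite -map_poly_comp; apply: eq_map_poly => n /=; rewrite ratr_int.
  by rewrite (E K) (E algC) !fmorph_root.
have /intrP[n en] : (ratr q : algC) \in Num.int.
  apply: Cint_rat_Aint; first by apply/CratP; exists q.
  apply: root_monic_Aint rq _ _; first exact: monic_map.
  by apply/polyOverP => i; rewrite coef_map /= intr_int.
by exists n; apply: (fmorph_inj (@ratr algC)); rewrite /= ratr_int.
Qed.

Lemma integralOver_rmorph (K L : fieldType) (f : {rmorphism K -> L}) x :
  integralOver (intr : int -> K) x -> integralOver (intr : int -> L) (f x).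
Proof.
move=> [P monP rootP]; exists P => //.
rewrite (_ : map_poly _ P = map_poly f (map_poly intr P)) ?fmorph_root //.
by rewrite -map_poly_comp; apply: eq_map_poly => n /=; rewrite rmorph_int.
Qed.

(** The square of the denominator of [r] divides [d]. *)
Lemma square_free_sqr_int (d : nat) (r : rat) (N : int) : square_free d ->
  d%:R * r ^+ 2 = N%:~R -> exists n : int, r = n%:~R.
Proof.
move=> sqf eN.
have b0 : 0 < denq r := denq_gt0 r.
have e : d%:Z * numq r ^+ 2 = N * denq r ^+ 2.
  apply: (@intr_inj rat); rewrite [LHS]rmorphM [RHS]rmorphM !rmorphXn /= -eN.
  by rewrite numqE exprMn mulrA.
have {}e : (d * `|numq r| ^ 2 = `|N| * `|denq r| ^ 2)%N.
  by have := congr1 absz e; rewrite [LHS]abszM [RHS]abszM !abszX.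
have dv : (`|denq r| ^ 2 %| d)%N.
  have : (`|denq r| ^ 2 %| d * `|numq r| ^ 2)%N by rewrite e dvdn_mull.
  by rewrite Gauss_dvdl // coprimeXl // coprimeXr // coprime_sym coprime_num_den.
have d1 : denq r = 1.
  case: (ltngtP `|denq r|%N 1%N) => [|h|]; [by lia | | by lia].
  have := sqf _ (pdiv_prime h); rewrite (dvdn_trans _ dv) //.
  by rewrite dvdn_exp2r // pdiv_dvd.
by exists (numq r); rewrite -[LHS]divq_num_den d1 divr1.
Qed.

Section QuadraticField.

Variables (d : nat) (F : fieldExtType rat) (s : F).
Hypotheses (d_gt1 : (1 < d)%N) (d_sqf : square_free d).
Hypotheses (s_sqr : s ^+ 2 = d%:R) (s_gen : <<1; s>>%VS = {:F}%VS).

Lemma sqrt_coordP (x : F) : exists c : rat * rat, x = c.1%:A + c.2 *: s.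
Proof.
have hx : x \in <<1; s>>%VS by rewrite s_gen memvf.
have P2 : ('X^2 - (d%:R)%:P : {poly F}) \is monic by rewrite monicXnsubC.
have deg : (adjoin_degree 1 s <= 2)%N.
  rewrite -ltnS -size_minPoly -(size_XnsubC (d%:R : F) (ltn0Sn 1)).
  apply: dvdp_leq; first exact: monic_neq0.
  apply: minPoly_dvdp; last by rewrite /root !hornerE s_sqr subrr.
  by rewrite rpredB ?rpredX ?polyOverX // polyOverC rpredMn ?rpred1.
have := Fadjoin_poly_eq hx; set P := Fadjoin_poly _ _ _ => ex.
have sP : (size P <= 2)%N by apply: leq_trans (size_Fadjoin_poly _ _ _) deg.
have /polyOverP PO : P \is a polyOver 1%VS := Fadjoin_polyOver _ _ _.
have /vlineP[c0 e0] := PO 0%N; have /vlineP[c1 e1] := PO 1%N.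
exists (c0, c1); rewrite -ex (horner_coef_wide _ sP) !big_ord_recl big_ord0 /=.
by rewrite e0 e1 addr0 expr0 mulr1 expr1 -scalerAl mul1r.
Qed.

Lemma rat_sqr_neq_d (q : rat) : q ^+ 2 != d%:R.
Proof.
apply/eqP => e; have d0 : (d%:R : rat) != 0 by rewrite pnatr_eq0; lia.
have [|n en] := @square_free_sqr_int d (q / d%:R) 1 d_sqf.
  by rewrite expr_div_n e; field.
have := congr1 (fun z => d%:R * z ^+ 2) en.
rewrite expr_div_n e (_ : d%:R * (d%:R / d%:R ^+ 2) = 1); last by field.
rewrite -rmorphXn -[d%:R]/(d%:Z%:~R) -rmorphM -[1]/(1%:~R) => /intr_inj h.
by have := dvdz_mulr (n ^+ 2) (dvdzz d%:Z); rewrite -h dvdzE dvdn1 => /eqP /=; lia.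
Qed.

Lemma sqrt_coord_inj (p q p' q' : rat) :
  p%:A + q *: s = p'%:A + q' *: s -> p = p' /\ q = q'.
Proof.
move=> e; have {}e : (q - q') *: s = (p' - p)%:A.
  have eX : q *: s = p'%:A + q' *: s - p%:A by rewrite -e addrAC subrr add0r.
  by rewrite !scalerBl eX; set u := _ *: s; ring.
have qq : q = q'.
  apply/eqP; rewrite -subr_eq0; apply/negP => /negP nz.
  have es : s = ((p' - p) / (q - q'))%:A.
    by rewrite mulrC -scalerA -e scalerA mulVf ?scale1r.
  have : ((p' - p) / (q - q')) ^+ 2 = d%:R.
    apply: (fmorph_inj (in_alg F)); rewrite rmorphXn /= -es s_sqr.
    by rewrite scaler_nat.
  by apply/eqP/rat_sqr_neq_d.
split=> //; move: e; rewrite qq subrr scale0r => /esym/eqP.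
by rewrite scaler_eq0 oner_eq0 orbF subr_eq0 eq_sym => /eqP.
Qed.

Lemma sqrt_embedding (t : R) : t ^+ 2 = d%:R ->
  exists sg : {rmorphism F -> R},
    forall p q : rat, sg (p%:A + q *: s) = ratr p + ratr q * t.
Proof.
move=> et; have [c hc] := choice sqrt_coordP.
pose f x := ratr (c x).1 + ratr (c x).2 * t : R.
have fE p q : f (p%:A + q *: s) = ratr p + ratr q * t.
  by have [] := sqrt_coord_inj (hc (p%:A + q *: s)); rewrite /f => <- <-.
have fB : zmod_morphism f.
  move=> x y; rewrite (hc x) (hc y) opprD addrACA -!scalerBl !fE !rmorphB /=; ring.
have fM : monoid_morphism f.
  split=> [|x y].
    rewrite -[1](_ : 1%:A + 0 *: s = _) ?fE ?scale1r ?scale0r ?addr0 //.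
    by rewrite rmorph1 rmorph0 mul0r addr0.
  rewrite (hc x) (hc y); case: (c x) (c y) => [p q] [p' q'] /=.
  have -> : (p%:A + q *: s) * (p'%:A + q' *: s) =
      (p * p' + d%:R * q * q')%:A + (p * q' + q * p') *: s.
    rewrite -!(mulr_algl _ s) -!in_algE !(rmorphD, rmorphM) rmorph_nat -s_sqr.
    by rewrite /=; ring.
  rewrite !fE !rmorphD !rmorphM /= ratr_nat -et; ring.
pose m1 := GRing.isZmodMorphism.Build _ _ f fB.
pose m2 := GRing.isMonoidMorphism.Build _ _ f fM.
pose g : {rmorphism F -> R} := HB.pack f m1 m2.
by exists g.
Qed.

(** The trace [2p] and the norm [p ^ 2 - d q ^ 2] are rational algebraic integers, and
    [d (2q) ^ 2] is a combination of them. *)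
Lemma alg_integer_coord (t : R) (p q : rat) : t ^+ 2 = d%:R ->
  p%:A + q *: s \in @alg_integer F ->
  exists T N n : int, [/\ 2 * p = T%:~R, 2 * q = n%:~R & d%:Z * n ^+ 2 = T ^+ 2 - 4 * N].
Proof.
move=> et /alg_integerP hx.
have [s1 h1] := sqrt_embedding et.
have [s2 h2] : exists sg : {rmorphism F -> R},
    forall p q : rat, sg (p%:A + q *: s) = ratr p + ratr q * - t.
  by apply: sqrt_embedding; rewrite sqrrN.
have i1 := integralOver_rmorph s1 hx; have i2 := integralOver_rmorph s2 hx.
have [T eT] : exists T : int, 2 * p = T%:~R.
  apply: (@integral_rat_int R); have := @integral_add int R intr _ _ i1 i2.
  by rewrite h1 h2 rmorphM /= ratr_nat; congr integralOver; ring.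
have [N eN] : exists N : int, p ^+ 2 - d%:R * q ^+ 2 = N%:~R.
  apply: (@integral_rat_int R); have := @integral_mul int R intr _ _ i1 i2.
  rewrite h1 h2 rmorphB /= rmorphXn [ratr (_ * _)]rmorphM /= rmorphXn ratr_nat -et.
  by congr integralOver; ring.
have eq2 : d%:R * (2 * q) ^+ 2 = (T ^+ 2 - 4 * N)%:~R.
  rewrite rmorphB rmorphXn [in RHS]rmorphM /= -eT -eN; ring.
have [n en] := square_free_sqr_int d_sqf eq2.
exists T, N, n; split=> //; apply: (@intr_inj rat).
by rewrite rmorphM /= rmorphXn /= -en.
Qed.

Lemma sqrt_alg_integer : s \in @alg_integer F.
Proof.
apply/alg_integerP; exists ('X^2 - (d%:Z)%:P); first by rewrite monicXnsubC.
by rewrite rmorphB /= map_polyXn map_polyC /root !hornerE s_sqr subrr.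
Qed.

Lemma half_sqrt_alg_integer : d = 1 %[mod 4] -> 2^-1%:A + 2^-1 *: s \in @alg_integer F.
Proof.
move=> d4; apply/alg_integerP; pose c := (d %/ 4)%N.
have dE : d = (4 * c + 1)%N by clear -d4; rewrite /c; lia.
exists ('X^2 - ('X + (c%:Z)%:P)).
  by rewrite monicE lead_coefDl ?lead_coefXn // size_polyN size_polyXn size_XaddC.
rewrite !(rmorphB, rmorphD) /= map_polyXn map_polyX map_polyC /root !hornerE.
rewrite -(mulr_algl _ s).
have -> : 2^-1%:A = 2^-1 :> F by rewrite -in_algE fmorphV rmorph_nat.
have n2 : (2 : F) != 0 by rewrite -(rmorph_nat (in_alg F)) fmorph_eq0.
have eC : c%:R = (s ^+ 2 - 1) / 4.
  rewrite s_sqr dE natrD natrM addrK mulrC mulKf //.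
  by rewrite -(rmorph_nat (in_alg F)) fmorph_eq0.
have n4 : (4 : F) != 0 by rewrite -(rmorph_nat (in_alg F)) fmorph_eq0.
rewrite -[X in _ - (_ + X)]/(c%:R) eC; apply/eqP; field.
by rewrite n4 n2.
Qed.

End QuadraticField.

(** All that is used of the arithmetic of [F].  The element [a] is an integral
    generator of the ring of integers, translated by a rational integer so that its second
    conjugate falls in the interval from 0 to 1. *)
Lemma real_quadratic_embeddings (d : nat) (F : fieldExtType rat)
    (S := Num.sqrt (discr d)%:R : R) :
  (1 < d)%N -> square_free d -> is_Q_sqrt d F ->
  exists s1 s2 : {rmorphism F -> R}, [/\
    forall x, x \in @alg_integer F -> exists b : int, s1 x - s2 x = b%:~R * S,
    forall x, x \in @alg_integer F -> s1 x = s2 x -> exists a : int, s1 x = a%:~R,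
    exists2 a, a \in @alg_integer F & s1 a = s2 a + S /\ 0 < s2 a <= 1
    & forall sg : {rmorphism F -> R}, sg =1 s1 \/ sg =1 s2].
Proof.
move=> d_gt1 d_sqf [s s_sqr s_gen].
pose t : R := Num.sqrt d%:R.
have et : t ^+ 2 = d%:R by rewrite sqr_sqrtr ?ler0n.
have t0 : 0 < t by rewrite sqrtr_gt0 ltr0n; lia.
have [s1 h1] := sqrt_embedding d_gt1 d_sqf s_sqr s_gen et.
have [s2 h2] : exists sg : {rmorphism F -> R},
    forall p q : rat, sg (p%:A + q *: s) = ratr p + ratr q * - t.
  by apply: (sqrt_embedding d_gt1 d_sqf s_sqr s_gen); rewrite sqrrN.
have SE : S = if d == 1 %[mod 4] then t else 2 * t.
  rewrite /S /discr; case: ifP => // _.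
  rewrite natrM sqrtrM ?ler0n // (_ : 4%:R = 2 ^+ 2) -?natrX //.
  by rewrite natrX sqrtr_sqr normr_nat.
have S0 : 0 < S by rewrite SE; case: ifP => _; lra.
exists s1, s2; split.
- move=> x hx; have [[p q] /= ex] := sqrt_coordP s_sqr s_gen x.
  rewrite ex in hx *; rewrite h1 h2.
  have [T [N [n [eT eq eN]]]] := alg_integer_coord d_gt1 d_sqf s_sqr s_gen et hx.
  have eqn : 2 * ratr q = n%:~R :> R by rewrite -(ratr_int R) -eq rmorphM /= ratr_nat.
  rewrite SE; case: ifP => d4.
    by exists n; rewrite -eqn; ring.
  (* For d = 2, 3 modulo 4 the congruence d n ^ 2 = T ^ 2 modulo 4 forces n to be even. *)
  have [k ek] : exists k : int, n = 2 * k.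
    have half (z : int) : exists k : int, z = 2 * k \/ z = 2 * k + 1.
      by exists (z %/ 2)%Z; lia.
    have [k [->|en]] := half n; first by exists k.
    have [j eT'] := half T; pose f := (d %/ 4)%N.
    have d2 : ~~ (4 %| d)%N by apply: (d_sqf 2%N).
    have fE : d = (4 * f + 2)%N \/ d = (4 * f + 3)%N by move: d4 d2; rewrite /f; lia.
    by move: eN; rewrite en; case: fE => ->; case: eT' => ->; lia.
  by exists k; move: eqn; rewrite ek rmorphM /= => eqn; nra.
- move=> x hx; have [[p q] /= ex] := sqrt_coordP s_sqr s_gen x.
  rewrite ex in hx *; rewrite h1 h2 => e.
  have q0 : ratr q = 0 :> R by nra.
  have [|n en] := @integral_rat_int R p.
    have /alg_integerP/(integralOver_rmorph s1) := hx.
    by rewrite h1 q0 mul0r addr0.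
  by exists n; rewrite q0 mul0r addr0 en ratr_int.
- have [w hw ew] : exists2 w, w \in @alg_integer F & s1 w - s2 w = S.
    rewrite SE; case: ifP => d4.
      exists (2^-1%:A + 2^-1 *: s).
        by apply: (half_sqrt_alg_integer s_sqr); apply/eqP.
      by rewrite h1 h2 rmorphV ?unitfE //= ratr_nat; field.
    exists s; first exact: (sqrt_alg_integer s_sqr).
    have := h1 0 1; have := h2 0 1.
    by rewrite scale0r scale1r add0r rmorph0 rmorph1 => -> ->; ring.
  exists (w + (Num.floor (- s2 w) + 1)%:~R).
    by rewrite rpredD // rpred_int.
  rewrite !rmorphD /= !rmorph_int; split; first by rewrite -ew; ring.
  have := Num.Theory.floor_itv (- s2 w); rewrite rmorphD /=; lra.
- move=> sg.
  have sE p q : sg (p%:A + q *: s) = ratr p + ratr q * sg s.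
    rewrite -(mulr_algl _ s) rmorphD rmorphM /= -!in_algE.
    rewrite -[sg _]/((sg \o in_alg F) p) -[sg (in_alg F q)]/((sg \o in_alg F) q).
    by rewrite !fmorph_eq_rat.
  have : sg s ^+ 2 == t ^+ 2 by rewrite -rmorphXn /= s_sqr rmorph_nat et.
  rewrite eqf_sqr => /orP[] /eqP es; [left|right] => x;
    by have [[p q] /= ->] := sqrt_coordP s_sqr s_gen x; rewrite sE es ?h1 ?h2.
Qed.

(** * The pairing of a quadratic lattice *)

Section Lattice.

Variables (F : fieldExtType rat) (L : quad_lattice F).

Lemma int_valM (a b : int_ring F) : val (a * b) = val a * val b.
Proof. by []. Qed.

Lemma int_val_nat n : val (n%:R : int_ring F) = n%:R.
Proof. by rewrite -[val _]/(\val _) rmorph_nat. Qed.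

(** Twice the bilinear form, which takes integral values also on non-classic lattices. *)
Definition pairing (x y : L) : int_ring F := quad (x + y) - quad x - quad y.

Lemma pairingE x y : val (pairing x y) = 2 * polar (@quad _ L) x y.
Proof.
rewrite /polar mulrC divfK; last by rewrite -(rmorph_nat (in_alg F)) fmorph_eq0.
by rewrite !rmorphB.
Qed.

Lemma pairingC x y : pairing x y = pairing y x.
Proof. by apply: val_inj; rewrite !pairingE quad_polar_sym. Qed.

Lemma pairing_linear (a : int_ring F) (x y z : L) :
  pairing (a *: x + y) z = a * pairing x z + pairing y z.
Proof.
apply: val_inj; rewrite -[RHS]/(val a * val (pairing x z) + val (pairing y z)) !pairingE.
have [h _] := @quad_polar_bilinear _ L.
have := h z a x y; rewrite /= => ->; ring.
Qed.

Variable sg : {rmorphism F -> R}.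

Definition rpairing (x y : L) : R := sg (val (pairing x y)).

Lemma rpairingC x y : rpairing x y = rpairing y x.
Proof. by rewrite /rpairing pairingC. Qed.

Lemma rpairingxx x : rpairing x x = 2 * sg (val (quad x)).
Proof. by rewrite /rpairing pairingE quad_polar_diag rmorphM rmorph_nat. Qed.

Lemma rpairing_linear (a : int_ring F) (x y z : L) :
  rpairing (a *: x + y) z = sg (val a) * rpairing x z + rpairing y z.
Proof. by rewrite /rpairing pairing_linear -rmorphM -rmorphD. Qed.

Lemma rpairing0 z : rpairing 0 z = 0.
Proof.
have := rpairing_linear 1 0 0 z; rewrite scaler0 addr0 => /eqP.
by rewrite -subr_eq0 opprD addrA addrAC subrr sub0r oppr_eq0 rmorph1 mul1r => /eqP.
Qed.

Lemma rpairing_lin2 (a b : int_ring F) (x y z : L) :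
  rpairing (a *: x + b *: y) z = sg (val a) * rpairing x z + sg (val b) * rpairing y z.
Proof. by rewrite rpairing_linear -[b *: y]addr0 rpairing_linear rpairing0 addr0. Qed.

Lemma rpairing_int_comb (m n k : int) (x y z : L) :
  let v := m%:~R *: x + (n%:~R *: y + k%:~R *: z) in
  rpairing v v =
    rpairing x x * m%:~R ^+ 2 + rpairing y y * n%:~R ^+ 2 + rpairing z z * k%:~R ^+ 2
    + 2 * (rpairing x y * m%:~R * n%:~R + rpairing x z * m%:~R * k%:~R
           + rpairing y z * n%:~R * k%:~R).
Proof.
move=> v.
have E w : rpairing v w = m%:~R * rpairing x w + n%:~R * rpairing y w + k%:~R * rpairing z w.
  have vi j : sg (val (j%:~R : int_ring F)) = j%:~R by rewrite !rmorph_int.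
  by rewrite /v rpairing_linear rpairing_lin2 !vi addrA.
by rewrite E !(rpairingC _ v) !E (rpairingC y x) (rpairingC z x) (rpairingC z y); ring.
Qed.

Hypothesis L_pos : pos_definite L.

Lemma rpairing_gt0 x : x != 0 -> 0 < rpairing x x.
Proof. by move=> /L_pos/(_ sg); rewrite rpairingxx pmulr_rgt0. Qed.

Lemma rpairing_ge0 x : 0 <= rpairing x x.
Proof. by have [->|/rpairing_gt0/ltW//] := eqVneq x 0; rewrite rpairing0. Qed.

(** The usual proof goes through because its coefficients, the pairings themselves, are scalars of
    the lattice. *)
Lemma rpairing_cauchy_schwarz x y : rpairing x y ^+ 2 <= rpairing x x * rpairing y y.
Proof.
have [->|y0] := eqVneq y 0; first by rewrite rpairingC !rpairing0 mulr0 expr0n.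
have := rpairing_ge0 (pairing y y *: x + - pairing x y *: y).
set z := _ + _; rewrite {1}/z rpairing_lin2 !(rpairingC _ z) /z !rpairing_lin2.
have -> : sg (val (- pairing x y)) = - rpairing x y by rewrite -rmorphN.
rewrite -/(rpairing y y) (rpairingC y x).
have := rpairing_gt0 y0.
set a := rpairing x x; set b := rpairing x y; set c := rpairing y y.
move=> c0 h; rewrite -subr_ge0 -(pmulr_rge0 _ c0).
by move: h; congr (_ <= _); ring.
Qed.

End Lattice.

(** Pairing with the [y j] is a linear map to row vectors, so by the universal property of the
    scalar extension it factors through a space of dimension [n], in which the images of the [m]
    vectors [y i] are dependent. *)
Lemma gram_kernel (F : fieldExtType rat) (L : quad_lattice F) (n m : nat) (y : 'I_m -> L) :
  has_rank L n -> (n < m)%N ->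
  exists2 u : 'I_m -> F, (exists i, u i != 0) &
    forall j, \sum_i u i * val (pairing (y i) (y j)) = 0.
Proof.
move=> [V [iota [ext dimV]]] nm.
pose f (x : L) : 'rV[F]_m := \row_j val (pairing x (y j)).
have f_lin : linear_for ((val : int_ring F -> F) \; *:%R) f.
  move=> a x z; apply/rowP => j; rewrite !mxE.
  by rewrite pairing_linear.
pose f' : {linear L -> 'rV[F]_m | (val : int_ring F -> F) \; *:%R} :=
  HB.pack f (GRing.isLinear.Build _ _ _ _ f f_lin).
have [[g gE] _] := ext _ f'.
have : ~~ free [tuple iota (y i) | i < m].
  rewrite /free size_tuple; apply/negP => /eqP e.
  by have := dimvS (subvf <<[tuple iota (y i) | i < m]>>%VS); rewrite e dimV leqNgt nm.
move=> nfree; apply: contrapT => noker; move/negP: nfree; apply; apply/freeP => u u0 i.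
apply/eqP/negP => /negP ui; apply: noker; exists u; first by exists i.
have dep : \sum_k u k *: iota (y k) = 0.
  by rewrite -[RHS]u0; apply: eq_bigr => k _; rewrite -tnth_nth tnth_mktuple.
move=> j; have : g (\sum_k u k *: iota (y k)) = 0 by rewrite dep raddf0.
rewrite linear_sum => /(congr1 (fun v : 'rV[F]_m => v 0 j)).
rewrite summxE mxE => e; rewrite -[RHS]e.
apply: eq_bigr => k _; rewrite linearZ mxE; congr (_ * _).
by have /= -> := gE (y k); rewrite mxE.
Qed.

(** * Vectors of norm k and of norm k * alpha *)

Lemma norm_le_of_sqr (K : realDomainType) (a b : K) :
  0 <= b -> a ^+ 2 <= b ^+ 2 -> `|a| <= b.
Proof.
by move=> b0 h; rewrite -(@ler_pXn2r _ 2) ?nnegrE // real_normK ?num_real.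
Qed.

(** The coefficient of [alpha] in a pairing obeys the Cauchy-Schwarz bound up to an error of order
    [1 / S], and hence exactly, once it is known to be an integer. *)
Lemma twisted_coef_bound (K : realFieldType) (A1 A2 c S a M : K) :
  10 ^+ 20 < S -> 0 < a <= 1 -> 0 <= M <= 62 ^+ 2 ->
  A1 = c * S + A2 -> A1 ^+ 2 <= M * (a + S) ^+ 2 -> A2 ^+ 2 <= M * a ^+ 2 ->
  c ^+ 2 < M + 1.
Proof.
move=> S_big /andP[a0 a1] /andP[M0 M1] eA h1 h2.
have S0 : 0 < S by apply: lt_trans S_big; rewrite exprn_gt0.
have S5 : 100 ^+ 3 < S by apply: lt_trans S_big; lra.
have aS : 0 <= a * (a + S) by rewrite mulr_ge0 // ?addr_ge0 // ltW.
have h3 : `|A1 * A2| <= M * (a * (a + S)).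
  apply: norm_le_of_sqr; first by rewrite mulr_ge0.
  have -> : (M * (a * (a + S))) ^+ 2 = (M * (a + S) ^+ 2) * (M * a ^+ 2) by ring.
  by rewrite exprMn ler_pM ?sqr_ge0.
have h4 : (c * S) ^+ 2 <= M * (2 * a + S) ^+ 2.
  have -> : c * S = A1 - A2 by rewrite eA addrK.
  have h5 : - (A1 * A2) <= M * (a * (a + S)) by apply: le_trans h3; rewrite -normrN ler_norm.
  by nra.
have h5 : M * (2 * a + S) ^+ 2 < (M + 1) * S ^+ 2.
  have h6 : (2 * a + S) ^+ 2 - S ^+ 2 <= 8 * S by nra.
  have h7 : M * ((2 * a + S) ^+ 2 - S ^+ 2) <= 62 ^+ 2 * (8 * S).
    by apply: ler_pM => //; nra.
  by nra.
have := le_lt_trans h4 h5; rewrite exprMn ltr_pM2r //; exact: exprn_gt0.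
Qed.

Section TwoFamilies.

Variables (F : fieldExtType rat) (L : quad_lattice F).
Hypothesis L_pos : pos_definite L.
Variables (s1 s2 : {rmorphism F -> R}) (S : R).
Hypothesis S_big : 10 ^+ 20 < S.
Hypothesis int_diff : forall a : int_ring F,
  exists b : int, s1 (val a) - s2 (val a) = b%:~R * S.
Hypothesis int_fixed : forall a : int_ring F,
  s1 (val a) = s2 (val a) -> exists n : int, s1 (val a) = n%:~R.

Variable x : nat -> L.
Hypothesis xQ : forall k, quad (x k) = k%:R.

Variables (alpha : int_ring F) (w : nat -> L).
Hypothesis alpha_diff : s1 (val alpha) = s2 (val alpha) + S.
Hypothesis alpha_small : 0 < s2 (val alpha) <= 1.
Hypothesis wQ : forall k, quad (w k) = k%:R * alpha.

Local Notation G1 := (rpairing s1).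
Local Notation G2 := (rpairing s2).

Let S_gt0 : 0 < S.
Proof. by apply: lt_trans S_big; rewrite exprn_gt0. Qed.

Lemma rpairing_eq_small (y z : L) : `|G1 y z - G2 y z| < S -> G1 y z = G2 y z.
Proof.
have [b eb] := int_diff (pairing y z); rewrite -/(G1 y z) -/(G2 y z) in eb.
rewrite eb normrM (gtr0_norm S_gt0) gtr_pMl // -intr_norm -[1]/(1%:~R) ltr_int => b1.
by apply/eqP; rewrite -subr_eq0 eb (_ : b = 0) ?mul0r //; lia.
Qed.

Lemma rational_diag (sg : {rmorphism F -> R}) k : rpairing sg (x k) (x k) = 2 * k%:R.
Proof. by rewrite rpairingxx xQ !rmorph_nat. Qed.

Lemma rational_bound (sg : {rmorphism F -> R}) k l :
  rpairing sg (x k) (x l) ^+ 2 <= 4 * k%:R * l%:R.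
Proof.
apply: le_trans (rpairing_cauchy_schwarz sg L_pos _ _) _.
by rewrite !rational_diag; lra.
Qed.

(** [rational_gramE] shows that the floor is exact for indices up to 31. *)
Definition rational_gram k l : int := Num.floor (G1 (x k) (x l)).

Lemma rational_gramE k l : (k <= 31)%N -> (l <= 31)%N ->
  G1 (x k) (x l) = (rational_gram k l)%:~R.
Proof.
move=> k31 l31.
have small sg : `|rpairing sg (x k) (x l)| <= 62.
  apply: norm_le_of_sqr => //; apply: le_trans (rational_bound _ _ _) _.
  rewrite -!natrM -natrX ler_nat; nia.
have [|n en] := int_fixed (a := pairing (x k) (x l)).
  apply: rpairing_eq_small; apply: le_lt_trans (ler_normB _ _) _.
  apply: le_lt_trans (lerD (small s1) (small s2)) _; apply: lt_trans S_big; lra.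
by rewrite /rational_gram -/(G1 _ _) in en *; rewrite en intrKfloor.
Qed.

Lemma rational_small_gram : small_gram rational_gram.
Proof.
split=> [k|k l|k l /andP[_ k31] /andP[_ l31]|k a b c /andP[_ k31] _ _ _].
- by rewrite /rational_gram rational_diag -natrM pmulrn intrKfloor.
- by rewrite /rational_gram rpairingC.
- rewrite -(ler_int R) rmorphXn /= -rational_gramE //.
  by apply: le_trans (rational_bound _ _ _) _; rewrite -!natrM.
- have := rpairing_ge0 s1 L_pos (a%:~R *: x 1%N + (b%:~R *: x 2%N + c%:~R *: x k)).
  rewrite rpairing_int_comb !rational_gramE // -(ler_int R).
  by rewrite !(rmorphD, rmorphM, rmorphXn) /=.
Qed.

Lemma twisted_diag (sg : {rmorphism F -> R}) k :
  rpairing sg (w k) (w k) = 2 * k%:R * sg (val alpha).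
Proof. by rewrite rpairingxx wQ int_valM rmorphM /= int_val_nat rmorph_nat mulrA. Qed.

Lemma twisted_bound (sg : {rmorphism F -> R}) k l :
  rpairing sg (w k) (w l) ^+ 2 <= 4 * k%:R * l%:R * sg (val alpha) ^+ 2.
Proof.
apply: le_trans (rpairing_cauchy_schwarz sg L_pos _ _) _.
by rewrite !twisted_diag le_eqVlt; apply/orP; left; apply/eqP; ring.
Qed.

Lemma twisted_small k l : (k <= 31)%N -> (l <= 31)%N -> `|G2 (w k) (w l)| <= 62.
Proof.
move=> k31 l31; apply: norm_le_of_sqr => //; apply: le_trans (twisted_bound _ _ _) _.
have -> : 62 ^+ 2 = 4 * 31 * 31 * 1 ^+ 2 :> R by lra.
have /andP[a0 a1] := alpha_small.
have k0 : 0 <= k%:R :> R by []; have l0 : 0 <= l%:R :> R by [].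
have kb : k%:R <= 31 :> R by rewrite ler_nat.
have lb : l%:R <= 31 :> R by rewrite ler_nat.
by rewrite !ler_pM ?mulr_ge0 ?exprn_ge0 ?lerXn2r ?nnegrE // ltW.
Qed.

(** The coefficient of [alpha] in the pairing; the floor is exact by [twisted_gramE]. *)
Definition twisted_gram k l : int := Num.floor ((G1 (w k) (w l) - G2 (w k) (w l)) / S).

Lemma twisted_gramE k l : G1 (w k) (w l) = (twisted_gram k l)%:~R * S + G2 (w k) (w l).
Proof.
have [b eb] := int_diff (pairing (w k) (w l)); rewrite -/(G1 _ _) -/(G2 _ _) in eb.
by rewrite /twisted_gram eb mulfK ?gt_eqF // intrKfloor -eb subrK.
Qed.

(** For positivity: the norm of a short combination under [s1] is nonnegative and equals [S] times
    the integer in question plus the norm under [s2], which is less than [S]. *)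
Lemma twisted_small_gram : small_gram twisted_gram.
Proof.
split=> [k|k l|k l /andP[_ k31] /andP[_ l31]|k a b c /andP[_ k31] ha hb hc].
- rewrite /twisted_gram !twisted_diag alpha_diff.
  rewrite (_ : _ / S = (2 * k)%:R); first by rewrite pmulrn intrKfloor.
  by rewrite natrM; field; rewrite gt_eqF.
- by rewrite /twisted_gram !(rpairingC _ (w k)).
- rewrite -ltzD1 -(ltr_int R) rmorphD rmorphXn /=.
  have b1 := twisted_bound s1 k l; have b2 := twisted_bound s2 k l.
  rewrite alpha_diff in b1; rewrite -pmulrn !natrM.
  apply: (twisted_coef_bound S_big alpha_small _ (twisted_gramE k l) b1 b2).
  by rewrite -!natrM -natrX ler0n ler_nat; nia.
- have := rpairing_ge0 s1 L_pos (a%:~R *: w 1%N + (b%:~R *: w 2%N + c%:~R *: w k)).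
  rewrite rpairing_int_comb !twisted_gramE.
  set X := _ + 2 * _ : int; set Y := _ + _.
  have {Y}-> : Y = X%:~R * S + (G2 (w 1%N) (w 1%N) * a%:~R ^+ 2 + G2 (w 2%N) (w 2%N) * b%:~R ^+ 2
     + G2 (w k) (w k) * c%:~R ^+ 2 + 2 * (G2 (w 1%N) (w 2%N) * a%:~R * b%:~R
     + G2 (w 1%N) (w k) * a%:~R * c%:~R + G2 (w 2%N) (w k) * b%:~R * c%:~R)).
    by rewrite /Y /X !(rmorphD, rmorphM, rmorphXn) /=; ring.
  have term i j (m n : int) : (i <= 31)%N -> (j <= 31)%N -> `|m| <= 30 -> `|n| <= 30 ->
      G2 (w i) (w j) * m%:~R * n%:~R <= 62 * 30 * 30.
    move=> hi hj hm hn; apply: le_trans (ler_norm _) _; rewrite !normrM -!intr_norm.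
    by rewrite !ler_pM ?mulr_ge0 ?ler0z ?twisted_small // (ler_int R _ 30).
  have t1 := term 1%N 1%N a a isT isT ha ha; have t2 := term 2%N 2%N b b isT isT hb hb.
  have t3 := term k k c c k31 k31 hc hc; have t4 := term 1%N 2%N a b isT isT ha hb.
  have t5 := term 1%N k a c isT k31 ha hc; have t6 := term 2%N k b c isT k31 hb hc.
  have S5 : 100 ^+ 3 < S by apply: lt_trans S_big; lra.
  rewrite !expr2 !mulrA => h.
  have : 0 < (X + 1)%:~R :> R by rewrite rmorphD /= -(pmulr_lgt0 _ S_gt0); lra.
  by rewrite ltr0z ltzD1.
Qed.

(** The product of the norms is of order [S] under [s1] and bounded under [s2], so the conjugates
    of the pairing differ by less than [S]. *)
Lemma mixed_pairing k l : (k <= 31)%N -> (l <= 31)%N ->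
  G1 (x k) (w l) = G2 (x k) (w l) /\ `|G1 (x k) (w l)| <= 62.
Proof.
move=> k31 l31; have /andP[a0 a1] := alpha_small.
have cs (sg : {rmorphism F -> R}) : 0 <= sg (val alpha) ->
    rpairing sg (x k) (w l) ^+ 2 <= 62 ^+ 2 * sg (val alpha).
  move=> sa0; apply: le_trans (rpairing_cauchy_schwarz sg L_pos _ _) _.
  rewrite rational_diag twisted_diag !mulrA ler_wpM2r //.
  by rewrite -!natrM -natrX ler_nat; nia.
have S5 : 100 ^+ 3 < S by apply: lt_trans S_big; lra.
have b2 : `|G2 (x k) (w l)| <= 62.
  by apply: norm_le_of_sqr => //; apply: le_trans (cs s2 (ltW a0)) _; nra.
have b1 : `|G1 (x k) (w l)| <= S - 63.
  by apply: norm_le_of_sqr; [lra | apply: le_trans (cs s1 _) _; rewrite alpha_diff; nra].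
have e : G1 (x k) (w l) = G2 (x k) (w l).
  by apply: rpairing_eq_small; apply: le_lt_trans (ler_normB _ _) _; lra.
by rewrite e.
Qed.

Lemma rank_ge8 n : has_rank L n -> (8 <= n)%N.
Proof.
move=> L_rank; rewrite leqNgt; apply/negP => n8.
have sA := rational_small_gram; have sB := twisted_small_gram.
have [k [k31 detA]] := escalation sA; have [l [l31 detB]] := escalation sB.
have kle i : (k i <= 31)%N by case/andP: (k31 i).
have lle i : (l i <= 31)%N by case/andP: (l31 i).
pose y (i : 'I_(4 + 4)) := match split i with inl j => x (k j) | inr j => w (l j) end.
have yl j : y (lshift 4 j) = x (k j) by rewrite /y (unsplitK (inl _ j)).
have yr j : y (rshift 4 j) = w (l j) by rewrite /y (unsplitK (inr _ j)).
have [u [i0 ui0] uker] := gram_kernel y L_rank n8.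
have ker j : \sum_(i < 4) rpairing s1 (x (k i)) (y j) * s1 (u (lshift 4 i))
    + \sum_(i < 4) rpairing s1 (w (l i)) (y j) * s1 (u (rshift 4 i)) = 0.
  have := congr1 s1 (uker j); rewrite rmorph0 rmorph_sum big_split_ord /= => e.
  by rewrite -[RHS]e; congr (_ + _); apply: eq_bigr => i _; rewrite rmorphM mulrC ?yl ?yr.
pose A : 'M[int]_4 := \matrix_(i, j) rational_gram (k i) (k j).
pose B : 'M[int]_4 := \matrix_(i, j) twisted_gram (l i) (l j).
have entry c (sc : small_gram c) i j :
    (0 < i <= 31)%N -> (0 < j <= 31)%N -> `|(c i j)%:~R : R| <= 62.
  move=> hi hj; rewrite -intr_norm (ler_int R _ 62); apply: norm_le_of_sqr => //.
  by apply: le_trans (small_gram_bound sc hi hj) _; nia.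
pose C (i j : 'I_4) := G1 (x (k i)) (w (l j)).
pose E (i j : 'I_4) := G2 (w (l i)) (w (l j)).
have [p0 r0] : (forall i : 'I_4, s1 (u (lshift 4 i)) = 0) /\
    (forall i : 'I_4, s1 (u (rshift 4 i)) = 0).
  apply: (@block_kernel_trivial R A B C E S) => //.
  - by move=> i j; rewrite mxE entry.
  - by move=> i j; rewrite mxE entry.
  - by move=> i j; have [] := mixed_pairing (kle i) (lle j).
  - by move=> i j; exact: twisted_small.
  - move=> i; have e := ker (lshift 4 i); rewrite yl in e; rewrite -[RHS]e.
    congr (_ + _); apply: eq_bigr => j _; last by rewrite rpairingC.
    by rewrite mxE (rpairingC _ (x (k j))) rational_gramE.
  - move=> i; have e := ker (rshift 4 i); rewrite yr in e; rewrite -[RHS]e.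
    congr (_ + _); apply: eq_bigr => j _ //.
    by rewrite mxE (rpairingC _ (w (l j))) twisted_gramE.
move/eqP: ui0; apply; apply: (fmorph_inj s1); rewrite rmorph0.
by case: (split_ordP i0) => j ->.
Qed.

End TwoFamilies.

(** * Universal lattices *)

(** Moves a bound on [n] from binary numbers to a symbolic power in unary ones, so that the large
    constant is never computed in [nat]. *)
Lemma pow_lt_of_N (b k n : nat) :
  N.lt (N.pow (N.of_nat b) (N.of_nat k)) (N.of_nat n) -> (b ^ k < n)%N.
Proof.
suff -> : N.pow (N.of_nat b) (N.of_nat k) = N.of_nat (b ^ k)%N by lia.
elim: k => [|k IH]; first by [].
by rewrite Nat2N.inj_succ N.pow_succ_r' IH expnS; lia.
Qed.

Lemma universal_rank_ge8 (d : nat) (F : fieldExtType rat) (L : quad_lattice F) (n : nat) :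
  (0 < d)%N -> square_free d -> is_Q_sqrt d F -> (10 ^ 40 < discr d)%N ->
  pos_definite L -> universal L -> has_rank L n -> (8 <= n)%N.
Proof.
move=> hd0 hd hF D_big L_pos L_univ.
have d_gt1 : (1 < d)%N.
  rewrite ltn_neqAle hd0 andbT eq_sym; apply/eqP => d1; move: D_big.
  by rewrite d1 [discr 1]/= ltnNge expn_gt0.
pose S : R := Num.sqrt (discr d)%:R.
have S_big : 10 ^+ 20 < S.
  have -> : 10 ^+ 20 = Num.sqrt ((10 ^ 40)%N%:R) :> R.
    rewrite natrX (_ : 40 = 20 * 2)%N // exprM sqrtr_sqr ger0_norm //.
    by rewrite exprn_ge0.
  by rewrite ltr_sqrt ?ltr_nat // ltr0n; apply: leq_trans D_big.
have [s1 [s2 [diff fixd [a0 a0int [a_diff a_small]] emb]]] :=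
  real_quadratic_embeddings d_gt1 hd hF.
pose alpha : int_ring F := IntRing a0int.
have repr (a : int_ring F) : tot_pos a \/ a = 0 -> exists x : L, quad x = a.
  move=> ha; have : range (@quad _ L) a by rewrite L_univ; case: ha; [left | right].
  by case=> x _ <-; exists x.
have /choice[x xQ] : forall k : nat, exists v : L, quad v = k%:R.
  move=> k; apply: repr; case: k => [|k]; [by right | left].
  by move=> sg; rewrite int_val_nat rmorph_nat ltr0n.
have /choice[w wQ] : forall k : nat, exists v : L, quad v = k%:R * alpha.
  move=> k; apply: repr; case: k => [|k]; [by right; rewrite mul0r | left].
  move=> sg; rewrite int_valM rmorphM /= int_val_nat rmorph_nat mulr_gt0 ?ltr0n //.
  have /andP[s2a _] := a_small.
  have S0 : 0 < S by apply: lt_trans S_big; rewrite exprn_gt0.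
  by case: (emb sg) => ->; rewrite // a_diff addr_gt0.
apply: (rank_ge8 L_pos S_big _ _ xQ (alpha := alpha) a_diff a_small wQ) => a.
- exact: diff (valP a).
- exact: fixd (valP a).
Qed.

Local Close Scope ring_scope.

Theorem theorem3p2 (d : nat) (F : fieldExtType rat)
    (hd0 : 0 < d) (hd : square_free d) (hF : is_Q_sqrt d F)
    (hD : (576283867731072000000005 ^ 2 < N.of_nat (discr d))%num) :
  ~ exists L : quad_lattice F,
      [/\ pos_definite L, ~ is_classic L, universal L & has_rank L 7].
Proof.
move=> [L [L_pos _ L_univ L_rank]].
have D_big : 10 ^ 40 < discr d.
  by apply: pow_lt_of_N; apply: N.lt_trans hD; vm_compute.
by have := universal_rank_ge8 hd0 hd hF D_big L_pos L_univ L_rank.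
Qed.
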